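(* For every $k\ge2$ and $s\ge2$ there exists a stratified Lie algebra of step $s$ and of some rank $m\ge k$ that is hypergenerated of order $k$.
   Context: A stratified Lie algebra of step $s$ is a finite-dimensional real nilpotent Lie algebra with a decomposition $\mathfrak g=V_1\oplus\dots\oplus V_s$ such that $[V_1,V_i]=V_{i+1}$ for $1\le i\le s-1$, $V_s\ne\{0\}$, $[V_1,V_s]=\{0\}$; its rank is $m=\dim V_1$. It is hypergenerated of order $k$ if every linear subspace $P\subseteq V_1$ with $\dim P=m-k$ satisfies $[\mathfrak g,\mathfrak g]\subseteq\mathrm{Lie}(P)$, where $\mathrm{Lie}(P)$ is the smallest Lie subalgebra of $\mathfrak g$ containing $P$. *)

(* Defs.v *)
From HB Require Import structures.
From mathcomp Require Import all_boot all_order all_algebra.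
From mathcomp Require Import classical_sets reals.

Set Implicit Arguments.
Unset Strict Implicit.
Unset Printing Implicit Defensive.

Import GRing.Theory.
Local Open Scope ring_scope.
Local Open Scope classical_set_scope.

HB.mixin Record Vector_isLie (F : fieldType) g of Vector F g := {
  lie : g -> g -> g;
  lie_is_linearl : forall y, linear (lie^~ y);
  lie_is_linearr : forall x, linear (lie x);
  liexx : forall x, lie x x = 0;
  lie_jacobi : forall x y z,
    lie x (lie y z) + lie y (lie z x) + lie z (lie x y) = 0
}.

#[short(type="lieType")]
HB.structure Definition Lie (F : fieldType) :=
  {g of Vector_isLie F g & Vector F g}.

Section Lie.
Variables (F : fieldType) (g : lieType F).
Implicit Types U V W P : {vspace g}.

(* [U, V] is the span of all brackets of elements of U and V; as for prodv,
   bases suffice by bilinearity (liev_subP). *)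
Definition liev U V : {vspace g} :=
  <<[seq lie x y | x <- vbasis U, y <- vbasis V]>>%VS.

Lemma liev_subP U V W :
  reflect (forall x y, x \in U -> y \in V -> lie x y \in W)
          (liev U V <= W)%VS.
Proof.
apply: (iffP span_subvP) => [UVW x y xU yV|UVW _ /allpairsP[[x y] [xU yV ->]]].
  pose lx z : g := lie z y.
  pose ly z : {linear g -> g} := HB.pack (lie z) (GRing.isLinear.Build _ _ _ _
    (lie z) (lie_is_linearr z)).
  pose lxL : {linear g -> g} := HB.pack lx (GRing.isLinear.Build _ _ _ _
    lx (lie_is_linearl y)).
  rewrite (coord_vbasis xU) -[lie _ _]/(lxL _) linear_sum memv_suml // => i _.
  rewrite linearZ memvZ //= /lx (coord_vbasis yV) -[lie _ _]/(ly _ _).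
  rewrite linear_sum memv_suml // => j _; rewrite linearZ memvZ //=.
  by apply/UVW/allpairs_f; rewrite mem_nth ?size_tuple.
by apply: UVW; exact: vbasis_mem.
Qed.

Definition lie_subalgebra (A : set g) : Prop :=
  [/\ A 0,
      forall (a : F) x y, A x -> A y -> A (a *: x + y)
    & forall x y, A x -> A y -> A (lie x y)].

Definition lie_gen (P : {vspace g}) : set g :=
  smallest lie_subalgebra [set` P].

Definition lie_nilpotent : Prop :=
  exists n, iter n (liev fullv) fullv = 0%VS.

End Lie.

(* The layers V_1, ..., V_s are [layer 1], ..., [layer s]; the values of
   [layer] at other indices are irrelevant (and s is meant to be positive). *)
Record stratifiedLie (R : realType) (s : nat) := StratifiedLie {
  strat_sort :> lieType R;
  layer : nat -> {vspace strat_sort};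
  strat_nilpotent : lie_nilpotent strat_sort;
  layer_sum : (\sum_(i < s) layer i.+1)%VS = fullv;
  layer_direct : directv (\sum_(i < s) layer i.+1);
  layer_lie : forall i, (1 <= i < s)%N -> liev (layer 1) (layer i) = layer i.+1;
  layer_last : layer s != 0%VS;
  layer_lie_last : liev (layer 1) (layer s) = 0%VS
}.

Definition lie_rank (R : realType) (s : nat) (g : stratifiedLie R s) : nat :=
  \dim (layer g 1).

(* dim P = m - k is written dim P + k = m to avoid truncated subtraction. *)
Definition hypergenerated (R : realType) (s : nat) (g : stratifiedLie R s)
    (k : nat) : Prop :=
  forall P : {vspace g}, (P <= layer g 1)%VS -> (\dim P + k)%N = lie_rank g ->
    [set` liev (fullv : {vspace g}) fullv] `<=` lie_gen P.

(* Main.v *)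
(* Let X be the space of univariate polynomials of degree at most k and M_i the
   dual of the space of polynomials of degree at most k (s - i). Multiplication
   by x in X has a transpose M_i -> M_(i+1); these transposes commute, so the
   semidirect product of X with M_1 + ... + M_s is a Lie algebra, stratified by
   V_1 = X + M_1 and V_i = M_i for i >= 2. Since a product of nonzero
   polynomials is nonzero, every nonzero x maps M_i onto M_(i+1).

   Let P in V_1 have codimension k. As dim X = k + 1, P is not contained in M_1,
   so [P, M_i] = M_(i+1). If [P, P] were not M_2, some nonzero polynomial q,
   seen as a functional on M_2, would vanish on it. Multiplication by q is
   injective on X, so it maps P to a space of dimension dim P - dim (P :&: M_1)
   which is orthogonal to P :&: M_1 inside a space of dimension dim M_1; then
   dim P <= dim M_1 = dim V_1 - (k + 1), a contradiction. *)
From HB Require Import structures.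
Require Import Defs.
From mathcomp Require Import all_boot all_order all_algebra.
From mathcomp Require Import classical_sets reals.

Set Implicit Arguments.
Unset Strict Implicit.
Unset Printing Implicit Defensive.

Import GRing.Theory Num.Theory.
Local Open Scope ring_scope.

(** * Linear algebra: functionals and dimensions *)

Lemma separating_functional (F : fieldType) (vT : vectType F)
    (W : {vspace vT}) (v : vT) :
  v \notin W ->
  exists phi : 'Hom(vT, F^o), phi v != 0 /\ forall w, w \in W -> phi w = 0.
Proof.
(* The complementary projection kills [W] but not [v], so one of its coordinates serves. *)
move=> vW; pose p : 'End(vT) := (\1 - projv W)%VF.
have pE u : p u = u - projv W u by rewrite add_lfunE opp_lfunE id_lfunE.
have pv : p v != 0.
  by apply: contra vW; rewrite pE subr_eq0 => /eqP ->; apply: memv_proj.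
have [j pvj] : exists j, coord (vbasis fullv) j (p v) != 0.
  apply/existsP; rewrite -negb_forall; apply: contra pv => /forallP h.
  rewrite (coord_vbasis (memvf (p v))) big1 // => j _.
  by rewrite (eqP (h j)) scale0r.
exists (linfun (coord (vbasis fullv) j : vT -> F^o) \o p)%VF; split.
  by rewrite comp_lfunE lfunE.
by move=> w wW; rewrite comp_lfunE pE projv_id // subrr linear0.
Qed.

(** Rank-nullity for [f] on [U], with kernel part and image independent inside [V]. *)
Lemma dim_ker_img_le (F : fieldType) (vT : vectType F) (f : 'End(vT))
    (U V : {vspace vT}) :
  (U :&: lker f <= V)%VS -> (f @: U <= V)%VS ->
  ((U :&: lker f) :&: (f @: U) = 0)%VS -> (\dim U <= \dim V)%N.
Proof.
move=> kV iV ki0; rewrite -[X in (X <= _)%N](limg_ker_dim f).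
by rewrite -dimv_disjoint_sum // dimvS // subv_add kV.
Qed.

(** * The graded module and its commuting operators *)

Section Model.
Variables (F : fieldType) (k s : nat).

Definition grid : seq (nat * nat) :=
  [seq (i, b) | i <- iota 1 s, b <- iota 0 (k * (s - i)).+1].

Lemma mem_grid i b : ((i, b) \in grid) = (0 < i <= s)%N && (b <= k * (s - i))%N.
Proof.
apply/allpairsPdep/idP => [[j [c [+ + [-> ->]]]]|/andP[ij bi]].
  by rewrite !mem_iota add1n !ltnS => -> ->.
by exists i, b; rewrite !mem_iota add1n !ltnS.
Qed.

(* The graded module M = M_1 + ... + M_s: an element of M_i is a sequence
   indexed by b <= k (s - i), i.e. a linear form on the polynomials of degree at
   most k (s - i). *)
Definition seqmod := {ffun seq_sub grid -> F^o}.

Definition coef i b (f : seqmod) : F^o := oapp f 0 (insub (i, b)).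

Definition seq_of (c : nat -> nat -> F) : seqmod :=
  [ffun u => c (ssval u).1 (ssval u).2].

Lemma coef_seq_of c i b :
  coef i b (seq_of c) = if (i, b) \in grid then c i b else 0.
Proof.
by rewrite /coef; case: insubP => [u -> /= e|/negPf ->] //=; rewrite ffunE e.
Qed.

Lemma coef_out f i b : (i, b) \notin grid -> coef i b f = 0.
Proof. by rewrite /coef; case: insubP => // u ->. Qed.

Lemma eq_coef f h :
  (forall i b, (i, b) \in grid -> coef i b f = coef i b h) -> f = h.
Proof.
move=> fh; apply/ffunP => u; have := fh (ssval u).1 (ssval u).2.
by rewrite /coef -surjective_pairing (valK u); apply; apply: ssvalP.
Qed.

Lemma coef_is_linear i b : linear (coef i b).
Proof.
move=> a f h; rewrite /coef; case: insub => [u|] /=; first by rewrite !ffunE.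
by rewrite scaler0 addr0.
Qed.
HB.instance Definition _ i b :=
  GRing.isLinear.Build F seqmod F^o _ (coef i b) (coef_is_linear i b).

Definition unitseq i b : seqmod :=
  seq_of (fun j c => ((j == i) && (c == b))%:R).

(* The transpose of multiplication by the polynomial with coefficients x, which
   maps M_i to M_(i+1). It vanishes in M_1 because [coef 0 b f] is 0. *)
Definition act (x : 'rV[F]_k.+1) (f : seqmod) : seqmod :=
  seq_of (fun i b => \sum_a x 0 a * coef i.-1 (b + a)%N f).

Lemma act_linearl f : linear (act^~ f).
Proof.
move=> a x y; apply: eq_coef => i b ib; rewrite linearP /= !coef_seq_of ib.
rewrite scaler_sumr -big_split; apply: eq_bigr => c _ /=.
by rewrite !mxE mulrDl -mulrA.
Qed.

Lemma act_linearr x : linear (act x).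
Proof.
move=> a f h; apply: eq_coef => i b ib; rewrite linearP /= !coef_seq_of ib.
rewrite scaler_sumr -big_split; apply: eq_bigr => c _ /=.
by rewrite linearP mulrDr [in LHS]mulrCA.
Qed.
HB.instance Definition _ x :=
  GRing.isLinear.Build F seqmod seqmod _ (act x) (act_linearr x).

Lemma act0 f : act 0 f = 0.
Proof.
apply: eq_coef => i b ib; rewrite coef_seq_of linear0 big1 ?if_same // => a _.
by rewrite mxE mul0r.
Qed.

(** Degrees add under multiplication: [k * (s - i)] is [k * (s - i.+1) + k], and [a <= k]. *)
Lemma grid_shift i b (a : 'I_k.+1) :
  (0 < i)%N -> (i.+1, b) \in grid -> (i, b + a)%N \in grid.
Proof.
rewrite !mem_grid => -> /andP[lis]; rewrite (ltnW lis) subnS /=.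
have : (0 < s - i)%N by rewrite subn_gt0.
case: (s - i)%N => // d _ /= bs; rewrite mulnS addnC leq_add //.
by rewrite -ltnS.
Qed.

(** Both sides pair [f] with the product of the polynomials [x] and [y], as a double sum over
    [coef i (b + a + c) f]. *)
Lemma actC x y f : act x (act y f) = act y (act x f).
Proof.
apply: eq_coef => [[|[|i]]] b ib; rewrite !coef_seq_of ib.
- by rewrite mem_grid in ib.
- by rewrite !big1 // => a _; rewrite coef_out ?mulr0 // mem_grid.
have E (z t : 'rV[F]_k.+1) : \sum_a z 0 a * coef i.+1 (b + a)%N (act t f) =
    \sum_a \sum_c z 0 a * (t 0 c * coef i (b + a + c)%N f).
  by apply: eq_bigr => a _; rewrite coef_seq_of grid_shift // mulr_sumr.
rewrite !E exchange_big /=; apply: eq_bigr => c _; apply: eq_bigr => a _.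
by rewrite mulrCA (addnAC b).
Qed.

(** * The semidirect product Lie algebra *)

Definition galg : Type := ('rV[F]_k.+1 * seqmod)%type.
HB.instance Definition _ := Vector.on galg.

Definition galg_lie (u v : galg) : galg := (0, act u.1 v.2 - act v.1 u.2).

Lemma galg_lie_linearl v : linear (galg_lie^~ v).
Proof.
move=> a u w; congr pair; rewrite /= ?scaler0 ?addr0 // act_linearl linearP.
by rewrite scalerBr opprD addrACA.
Qed.

Lemma galg_lie_linearr u : linear (galg_lie u).
Proof.
move=> a v w; congr pair; rewrite /= ?scaler0 ?addr0 // act_linearl linearP.
by rewrite scalerBr opprD addrACA.
Qed.

Lemma galg_liexx u : galg_lie u u = 0.
Proof. by rewrite /galg_lie subrr. Qed.

Lemma galg_lie_jacobi u v w :
  galg_lie u (galg_lie v w) + galg_lie v (galg_lie w u) +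
    galg_lie w (galg_lie u v) = 0.
Proof.
case: u v w => [x f] [y h] [z l]; congr pair; first by rewrite /= !addr0.
rewrite /= !act0 !subr0 !linearB /= (actC y x) (actC z x) (actC z y).
by rewrite [X in X + _]addrC !subrKA subrr.
Qed.

HB.instance Definition _ := Vector_isLie.Build F galg
  galg_lie_linearl galg_lie_linearr galg_liexx galg_lie_jacobi.

(** * Graded pieces and nondegeneracy of the action *)

Lemma coef_act x f i b : (i, b) \in grid ->
  coef i b (act x f) = \sum_a x 0 a * coef i.-1 (b + a)%N f.
Proof. by move=> ib; rewrite coef_seq_of ib. Qed.

Lemma coef_act_eq0 x f i : (forall b, coef i.-1 b f = 0) ->
  forall b, coef i b (act x f) = 0.
Proof.
by move=> f0 b; rewrite coef_seq_of big1 ?if_same // => a _; rewrite f0 mulr0.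
Qed.

(* p says whether the abelian factor is kept, D which components of M are. *)
Definition trunc (p : bool) (D : pred nat) (v : galg) : galg :=
  (if p then v.1 else 0, seq_of (fun i b => if D i then coef i b v.2 else 0)).

Lemma trunc_linear p D : linear (trunc p D).
Proof.
move=> a u v; congr pair => /=; first by case: p; rewrite ?scaler0 ?addr0.
apply: eq_coef => i b ib; rewrite linearP /= !coef_seq_of ib.
by case: (D i); rewrite ?linearP ?scaler0 ?addr0.
Qed.
HB.instance Definition _ p D :=
  GRing.isLinear.Build F galg galg _ (trunc p D) (trunc_linear p D).

(** As [trunc p D] is a projection, its fixed space is its image. *)
Definition gsupp p D : {vspace galg} := fixedSpace (linfun (trunc p D)).

Lemma mem_gsupp p D v : v \in gsupp p D <->
  (~~ p -> v.1 = 0) /\ (forall i b, ~~ D i -> coef i b v.2 = 0).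
Proof.
split=> [/fixedSpaceP|[v1 v2]].
  rewrite lfunE /= => <-; split=> [/negPf -> //|i b /negPf Di].
  by rewrite coef_seq_of Di if_same.
apply/fixedSpaceP; rewrite lfunE /= [RHS]surjective_pairing; congr pair.
  by case: p v1 => // ->.
by apply: eq_coef => i b ib; rewrite coef_seq_of ib; case: ifPn => // /v2 ->.
Qed.

Definition glayer i : {vspace galg} := gsupp (i == 1%N) (pred1 i).
Definition gcomp i : {vspace galg} := gsupp false (pred1 i).

Lemma glayerE i : i != 1%N -> glayer i = gcomp i.
Proof. by rewrite /glayer => /negPf ->. Qed.

Lemma gcomp_sub i : (gcomp i <= glayer i)%VS.
Proof.
by apply/subvP => v /mem_gsupp[v1 v2]; apply/mem_gsupp; split=> // _; apply: v1.
Qed.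

Definition seq_elt (f : seqmod) : galg := (0, f).

Lemma seq_elt_linear : linear seq_elt.
Proof.
by move=> a f h; rewrite /seq_elt; congr pair; rewrite /= ?scaler0 ?addr0.
Qed.
HB.instance Definition _ :=
  GRing.isLinear.Build F seqmod galg _ seq_elt seq_elt_linear.

Lemma lie_seq_elt (u : galg) f : lie u (seq_elt f) = seq_elt (act u.1 f).
Proof. by rewrite /lie /= /galg_lie /= act0 subr0. Qed.

Lemma coef_unitseq i b j c : (j, c) \in grid ->
  coef j c (unitseq i b) = ((j == i) && (c == b))%:R.
Proof. by move=> jc; rewrite coef_seq_of jc. Qed.

Lemma unitseq_comp i b : seq_elt (unitseq i b) \in gcomp i.
Proof.
apply/mem_gsupp; split=> // j c /= /negPf ji.
by rewrite coef_seq_of ji if_same.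
Qed.

Lemma unitseq_decomp i f : (0 < i <= s)%N ->
  (forall j b, j != i -> coef j b f = 0) ->
  f = \sum_(b < (k * (s - i)).+1) coef i b f *: unitseq i b.
Proof.
move=> lis f0; apply: eq_coef => j c jc; rewrite linear_sum /=.
under eq_bigr do rewrite linearZ /= coef_unitseq //.
have [->|ji] := eqVneq j i; last first.
  by rewrite f0 // big1 // => b _; rewrite scaler0.
case: (boolP ((i, c) \in grid)) => [ic|ic]; last first.
  rewrite coef_out // big1 // => b _; case: eqVneq => [cb|_] /=;
    last by rewrite scaler0.
  by rewrite -cb coef_out // scale0r.
move: ic; rewrite mem_grid lis -ltnS => lc.
rewrite (bigD1 (Ordinal lc)) //= eqxx big1 ?addr0.
  by rewrite /GRing.scale /= mulr1.
move=> b; rewrite -val_eqE /= eq_sym => /negPf ->.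
by rewrite scaler0.
Qed.

Lemma gcomp_decomp i v : (0 < i <= s)%N -> v \in gcomp i ->
  v = \sum_(b < (k * (s - i)).+1) coef i b v.2 *: seq_elt (unitseq i b).
Proof.
move=> lis /mem_gsupp[v1 v2].
under eq_bigr do rewrite -linearZ.
rewrite -linear_sum /= -unitseq_decomp //.
by rewrite [LHS]surjective_pairing v1.
Qed.

(* The pairing phi(x . f) is the coefficient pairing of f with the product of
   the polynomials x and q, where q lists the values of phi; so it is
   nondegenerate because {poly F} has no zero divisors. *)
Lemma act_nondegenerate (phi : 'Hom(galg, F^o)) x i v :
  (0 < i < s)%N -> v \in gcomp i.+1 -> phi v != 0 -> x != 0 ->
  exists c, phi (seq_elt (act x (unitseq i c))) != 0.
Proof.
move=> /andP[i0 lis] vi phiv x0.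
pose N := (k * (s - i.+1)).+1.
pose p := \poly_(a < k.+1) x 0 (inord a).
pose q := \poly_(b < N) phi (seq_elt (unitseq i.+1 b)).
have p0 : p != 0.
  apply: contra x0 => /eqP/polyP h; apply/eqP/rowP => a.
  by have := h a; rewrite coef_poly coef0 ltn_ord inord_val mxE.
have q0 : q != 0.
  apply: contra phiv => /eqP/polyP h; rewrite (gcomp_decomp _ vi) //.
  rewrite linear_sum big1 //= => b _; rewrite linearZ /=.
  by have := h b; rewrite coef_poly coef0 ltn_ord => ->; rewrite scaler0.
(* The witness is the degree of [p * q]: the pairing there is the leading coefficient, hence
   nonzero. *)
exists (size (p * q)).-1; set c := _.-1.
suff -> : phi (seq_elt (act x (unitseq i c))) = (p * q)`_c.
  by rewrite -lead_coefE lead_coef_eq0 mulf_neq0.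
have ai : seq_elt (act x (unitseq i c)) \in gcomp i.+1.
  apply/mem_gsupp; split=> // j b /= ji; case: j ji => [|j] ji.
    by rewrite coef_out // mem_grid.
  apply: coef_act_eq0 => d /=.
  by rewrite coef_seq_of -eqSS (negPf ji) if_same.
rewrite (gcomp_decomp _ ai) // linear_sum /= mulrC.
have -> : p = \sum_a x 0 a *: 'X^a.
  by rewrite /p poly_def; apply: eq_bigr => a _; rewrite inord_val.
rewrite /q poly_def mulr_suml coef_sum; apply: eq_bigr => b _.
rewrite linearZ /= mulr_sumr coef_sum coef_act; last first.
  by rewrite mem_grid lis /= -ltnS ltn_ord.
rewrite [LHS]scaler_suml; apply: eq_bigr => a _ /=.
rewrite -scalerAl -scalerAr -exprD !coefZ coefXn.
rewrite coef_unitseq ?eqxx; last first.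
  by apply: grid_shift => //; rewrite mem_grid lis /= -ltnS ltn_ord.
by rewrite /GRing.scale /= [c == _]eq_sym mulrC.
Qed.

(** A functional that vanishes on [liev P U] but not on [gcomp i.+1] would kill every bracket of [p]
    with a unit sequence, against nondegeneracy. *)
Lemma gcomp_sub_liev (P U : {vspace galg}) (p : galg) i :
  (0 < i < s)%N -> p \in P -> p.1 != 0 -> (gcomp i <= U)%VS ->
  (gcomp i.+1 <= liev P U)%VS.
Proof.
move=> lis pP p0 iU; apply/subvP => v vi; apply/negPn/negP => vPU.
have [phi [phiv phi0]] := separating_functional vPU.
have [c] := act_nondegenerate lis vi phiv p0.
rewrite -lie_seq_elt phi0 ?eqxx //; apply/(liev_subP P U) => //.
by apply: (subvP iU); apply: unitseq_comp.
Qed.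

(** * Stratification, nilpotency and rank *)

Lemma glayer_graded i u v : (0 < i)%N -> u \in glayer 1 -> v \in glayer i ->
  lie u v \in glayer i.+1.
Proof.
move=> i0 /mem_gsupp[_ u2] /mem_gsupp[v1 v2].
apply/mem_gsupp; split=> // j b /= ji; rewrite linearB /=.
case: j ji => [|j ji]; first by rewrite !coef_out ?subrr // mem_grid.
rewrite coef_act_eq0 ?sub0r => [|c]; last exact: v2.
apply/eqP; rewrite oppr_eq0; apply/eqP.
have [i1|/v1 ->] := eqVneq i 1%N; last by rewrite act0 linear0.
by apply: coef_act_eq0 => c; apply: u2; rewrite i1 in ji.
Qed.

Lemma glayer_lie i : (0 < i < s)%N -> liev (glayer 1) (glayer i) = glayer i.+1.
Proof.
move=> lis; apply/eqP; rewrite eqEsubv; apply/andP; split.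
  by apply/liev_subP => u v; apply: glayer_graded; case/andP: lis.
rewrite glayerE; last by rewrite eqSS -lt0n; case/andP: lis.
apply: (@gcomp_sub_liev _ _ (const_mx 1, 0)) => //; last exact: gcomp_sub.
  by apply/mem_gsupp; split=> // j b _; rewrite linear0.
by apply/eqP => /rowP/(_ 0); rewrite !mxE => /eqP; rewrite oner_eq0.
Qed.

Lemma glayer_oversize i : (0 < s < i)%N -> glayer i = 0%VS.
Proof.
case/andP=> s0 si; have i1 : i != 1%N by apply: contraTneq si => ->; case: s s0.
apply/eqP; rewrite glayerE // -subv0; apply/subvP => v /mem_gsupp[v1 v2].
rewrite memv0 [v]surjective_pairing v1 //; apply/eqP; congr pair.
apply: eq_coef => j b jb; rewrite linear0 v2 //= neq_ltn.
by move: jb; rewrite mem_grid => /andP[/andP[_ /leq_ltn_trans->]].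
Qed.

Lemma glayer_neq0 i : (0 < i <= s)%N -> glayer i != 0%VS.
Proof.
move=> lis; apply/negP => /eqP L0.
have : seq_elt (unitseq i 0) \in glayer i.
  by apply: (subvP (gcomp_sub i)); apply: unitseq_comp.
rewrite L0 memv0 => /eqP[/(congr1 (coef i 0))/eqP].
by rewrite coef_unitseq ?mem_grid ?lis // linear0 !eqxx oner_eq0.
Qed.

Lemma galg_decomp (v : galg) : (0 < s)%N ->
  v = \sum_(i < s) trunc (val i == 0)%N (pred1 i.+1) v.
Proof.
move=> s0; rewrite [LHS]surjective_pairing [RHS]surjective_pairing.
congr pair.
  rewrite (big_morph fst (id1 := 0) (op1 := +%R)) //.
  rewrite (bigD1 (Ordinal s0)) //= big1 ?addr0 // => i.
  by rewrite -val_eqE /= => /negPf ->.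
rewrite (big_morph snd (id1 := 0) (op1 := +%R)) //.
apply: eq_coef => j b jb; rewrite linear_sum /=.
under eq_bigr do rewrite coef_seq_of jb /=.
have [j0 js] : (0 < j)%N /\ (j.-1 < s)%N.
  by move: jb; rewrite mem_grid; case: j => // j /andP[].
rewrite (bigD1 (Ordinal js)) //= prednK // eqxx big1 ?addr0 // => i.
by rewrite -val_eqE /= -eqSS prednK // eq_sym => /negPf ->.
Qed.

Lemma trunc_glayer i v : trunc (i == 0)%N (pred1 i.+1) v \in glayer i.+1.
Proof.
apply/mem_gsupp; rewrite eqSS /trunc; split=> [/negPf -> //|j b /negPf ji].
by rewrite coef_seq_of ji if_same.
Qed.

Lemma trunc_id i v :
  v \in glayer i.+1 -> trunc (i == 0)%N (pred1 i.+1) v = v.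
Proof. by rewrite /glayer eqSS => /fixedSpaceP; rewrite lfunE. Qed.

Lemma trunc_eq0 i j v : v \in glayer j.+1 -> i != j ->
  trunc (i == 0)%N (pred1 i.+1) v = 0.
Proof.
move=> /mem_gsupp[v1 v2] ij; congr pair => /=.
  by case: (eqVneq i 0%N) ij => // ->; rewrite eq_sym => j0; rewrite v1 // eqSS.
apply: eq_coef => d b db; rewrite linear0 coef_seq_of db.
case: (eqVneq d) => // ->.
by rewrite v2 //= eqSS.
Qed.

Lemma glayer_sum : (0 < s)%N -> (\sum_(i < s) glayer i.+1)%VS = fullv.
Proof.
move=> s0; apply/eqP; rewrite eqEsubv subvf /=; apply/subvP => v _.
by rewrite (galg_decomp v s0); apply: memv_sumr => i _; apply: trunc_glayer.
Qed.

Lemma glayer_direct : directv (\sum_(i < s) glayer i.+1).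
Proof.
apply/directv_sum_independent => us us_i us0 i _.
have := congr1 (trunc (val i == 0)%N (pred1 i.+1)) us0.
rewrite linear0 linear_sum /=.
rewrite (bigD1 i) //= trunc_id ?us_i // big1 ?addr0 // => j ji.
by apply: trunc_eq0 (us_i j _) _; rewrite // eq_sym.
Qed.

(** Each bracket drops the abelian part and raises degrees by one. The case [n = 1] also locates the
    derived algebra. *)
Lemma lower_central (n : nat) :
  (iter n (liev fullv) fullv <= gsupp (n == 0)%N (fun j => n < j)%N)%VS.
Proof.
elim: n => [|n IHn] /=.
  apply/subvP => v _; apply/mem_gsupp; split=> // -[|//] b _.
  by rewrite coef_out // mem_grid.
apply/liev_subP => u v _ /(subvP IHn)/mem_gsupp[v1 v2].
apply/mem_gsupp; split=> // j b; rewrite -leqNgt => jn; rewrite linearB /=.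
rewrite coef_act_eq0 ?sub0r => [|c]; last first.
  by apply: v2; rewrite -leqNgt -subn1 leq_subLR.
apply/eqP; rewrite oppr_eq0; apply/eqP.
(* For [n = 0] the abelian part of [v] may survive, but it acts into degrees at least 2. *)
case: n v1 jn {IHn v2} => [_ jn|n -> // _].
  apply: coef_act_eq0 => c; rewrite coef_out // mem_grid.
  by case: j jn => [|[]].
by rewrite act0 linear0.
Qed.

Lemma galg_nilpotent : lie_nilpotent galg.
Proof.
exists s.+1; apply/eqP; rewrite -subv0; apply: subv_trans (lower_central _) _.
apply/subvP => v /mem_gsupp[v1 v2]; rewrite memv0 [v]surjective_pairing v1 //.
apply/eqP; congr pair; apply: eq_coef => i b ib; rewrite linear0 v2 // -leqNgt.
by move: ib; rewrite mem_grid => /andP[/andP[_ /leqW]].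
Qed.

Lemma dim_glayer1 : \dim (glayer 1) = (\dim (gcomp 1) + k.+1)%N.
Proof.
pose f : 'Hom(galg, 'rV[F]_k.+1) := linfun fst.
rewrite -(limg_ker_dim f); congr addn.
  congr (\dim _); apply/vspaceP => v; rewrite memv_cap memv_ker lfunE /=.
  apply/andP/idP => [[/mem_gsupp[_ v2] /eqP v1]|/mem_gsupp[v1 v2]].
    exact/mem_gsupp.
  by rewrite v1 // eqxx; split=> //; apply/mem_gsupp.
transitivity (\dim {: 'rV[F]_k.+1}); last by rewrite dimvf dim_matrix mul1r.
congr (\dim _); apply/vspaceP => x; rewrite memvf.
apply/memv_imgP; exists (x, 0).
  by apply/mem_gsupp; split=> // j b _; rewrite linear0.
by rewrite lfunE.
Qed.

End Model.

(** * The dimension bound for isotropic subspaces *)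

Section Isotropic.
Variables (F : realFieldType) (k s : nat).
Local Notation g := (galg F k s).

(* phi ([u, f]) is the standard inner product of [pairing_vector phi u] with
   [f], for [f] in the first graded component. *)
Definition pairing_vector (phi : 'Hom(g, F^o)) (u : g) : g :=
  seq_elt (seq_of k s (fun j c =>
    if j == 1%N then phi (seq_elt (act u.1 (unitseq F k s 1 c))) else 0)).

Lemma pairing_vector_linear phi : linear (pairing_vector phi).
Proof.
move=> a u v; rewrite /pairing_vector -linearP; congr seq_elt.
apply: eq_coef => j c jc; rewrite [RHS]linearP /= !coef_seq_of jc.
case: eqP => _; first by rewrite act_linearl !linearP.
by rewrite scaler0 addr0.
Qed.
HB.instance Definition _ phi :=
  GRing.isLinear.Build F g g _ (pairing_vector phi) (pairing_vector_linear phi).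

(** Apply [dim_ker_img_le] to [pairing_vector phi], where [phi] vanishes on [W] but not on
    [gcomp 2]. Nondegeneracy puts the kernel part in [gcomp 1]. *)
Lemma isotropic_dim (P W : {vspace g}) :
  (1 < s)%N -> (liev P P <= W)%VS -> ~~ (gcomp F k s 2 <= W)%VS ->
  (P <= glayer F k s 1)%VS -> (\dim P <= \dim (gcomp F k s 1))%N.
Proof.
move=> s1 PW /subvPn[v v2 vW] P1.
have [phi [phiv phi0]] := separating_functional vW.
have [T TE] : exists T : 'End(g), forall u, T u = pairing_vector phi u.
  by exists (linfun (pairing_vector phi)) => u; rewrite lfunE.
have TP u : T u \in gcomp F k s 1.
  rewrite TE; apply/mem_gsupp; split=> // j b /= /negPf j1.
  by rewrite coef_seq_of j1 if_same.
have T0 u : T u = 0 -> u.1 = 0.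
  rewrite TE => -[/(congr1 (coef 1 _)) Tu]; apply/eqP/negPn/negP => u0.
  have [c] := act_nondegenerate (i := 1) s1 v2 phiv u0.
  (* The index [c] may lie off the grid, where the unit sequence is zero. *)
  case: (boolP ((1%N, c) \in grid k s)) => c1.
    by have := Tu c; rewrite linear0 coef_seq_of c1 eqxx => ->; rewrite eqxx.
  suff -> : unitseq F k s 1 c = 0 by rewrite !linear0 eqxx.
  apply: eq_coef => j b jb; rewrite linear0 coef_unitseq //.
  by case: andP => // -[/eqP j1 /eqP bc]; rewrite j1 bc (negPf c1) in jb.
have K1 : (P :&: lker T <= gcomp F k s 1)%VS.
  apply/subvP => u; rewrite memv_cap memv_ker => /andP[uP /eqP Tu].
  have /mem_gsupp[_ u2] := subvP P1 _ uP.
  by apply/mem_gsupp; split=> // _; apply: T0.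
(* An element u of both equals T p with phi [p, u] = 0, so it is orthogonal to
   itself. *)
have KT0 : ((P :&: lker T) :&: (T @: P) = 0)%VS.
  apply/eqP; rewrite -subv0; apply/subvP => u; rewrite memv_cap memv0.
  move=> /andP[uK /memv_imgP[p pP uT]].
  have uP : u \in P by move: uK; rewrite memv_cap => /andP[].
  have u1 := subvP K1 _ uK.
  have lis : (0 < 1 <= s)%N by apply: ltnW.
  have /mem_gsupp[v1 v2'] := u1.
  have uE : u = seq_elt u.2 by rewrite [LHS]surjective_pairing v1.
  have : phi (lie p u) = 0.
    by apply: phi0; apply: (subvP PW); apply/(liev_subP P P _ (subvv _)).
  rewrite uE lie_seq_elt [X in act _ X](unitseq_decomp lis v2') !linear_sum /=.
  under eq_bigr => b _.
    rewrite !linearZ /=.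
    have -> : phi (seq_elt (act p.1 (unitseq F k s 1 b))) = coef 1 b u.2.
      by rewrite uT TE coef_seq_of eqxx mem_grid lis /= -ltnS ltn_ord.
    over.
  move/eqP; rewrite psumr_eq0 => [/allP h|b _]; last exact: sqr_ge0.
  rewrite (unitseq_decomp lis v2') big1 ?linear0 // => b _.
  suff -> : coef 1 b u.2 = 0 by rewrite scale0r.
  by apply/eqP; have := h b (mem_index_enum b); rewrite [_ == 0]mulf_eq0 orbb.
apply: dim_ker_img_le K1 _ KT0.
by apply/subvP => _ /memv_imgP[u _ ->]; apply: TP.
Qed.

End Isotropic.

(** * Hypergeneration *)

Lemma liev_sub_subalgebra (F : fieldType) (g : lieType F) (A : set g)
    (U V : {vspace g}) :
  lie_subalgebra A -> (forall u, u \in U -> A u) ->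
  (forall v, v \in V -> A v) ->
  forall w, w \in liev U V -> A w.
Proof.
move=> [A0 Alin Alie] UA VA w wUV.
set X := [seq lie x y | x <- vbasis U, y <- vbasis V].
rewrite (coord_span (X := in_tuple X) wUV).
elim/big_rec: _ => // i u _ Au; apply: Alin => //.
have /allpairsP[[x y] [/= /vbasis_mem xU /vbasis_mem yV ->]] : X`_i \in X.
  exact: mem_nth.
by apply: Alie; [apply: UA | apply: VA].
Qed.

Theorem proposition3p23 (R : realType) (k s : nat)
    (hk : (2 <= k)%N) (hs : (2 <= s)%N) :
  exists g : stratifiedLie R s, (k <= lie_rank g)%N /\ hypergenerated g k.
Proof.
have s0 : (0 < s)%N by apply: ltnW.
pose L := glayer R k s.
have last_neq0 : L s != 0%VS by apply: glayer_neq0; rewrite s0 /=.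
have lie_last : liev (L 1%N) (L s) = 0%VS.
  apply/eqP; rewrite -subv0 -(@glayer_oversize R k s s.+1) ?s0 ?ltnSn //.
  by apply/liev_subP => u v; apply: glayer_graded.
pose g := StratifiedLie (galg_nilpotent R k s) (glayer_sum R k s0)
  (glayer_direct R k s) (@glayer_lie R k s) last_neq0 lie_last.
exists g; split.
  by rewrite /lie_rank /= dim_glayer1 addnS ltnW // ltnS leq_addl.
move=> P P1; rewrite /lie_rank /= dim_glayer1 => dimP w /= w2 A [Asub PA].
(* The abelian factor has dimension [k.+1], so [P] is one dimension too large to be isotropic or to
   lie in [gcomp 1]. *)
have ltP : (\dim (gcomp R k s 1) < \dim P)%N.
  by rewrite -(ltn_add2r k) dimP ltn_add2l.
have P2 : (L 2 <= liev P P)%VS.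
  apply: contraLR ltP; rewrite -leqNgt => nP2.
  exact: isotropic_dim (subvv _) nP2 P1.
have [p pP p0] : exists2 p, p \in P & p.1 != 0.
  have /subvPn[p pP pn] : ~~ (P <= gcomp R k s 1)%VS.
    by apply: contraL ltP => /dimvS; rewrite -leqNgt.
  exists p => //; apply: contra pn => /eqP p0; apply/mem_gsupp; split=> //.
  by case/mem_gsupp: (subvP P1 _ pP).
(* Only the second layer uses the isotropy bound; bracketing with [p] then climbs from each layer to
   the next. *)
have LA i : (i.+1 < s)%N -> forall v, v \in L i.+2 -> A v.
  elim: i => [|i IHi] lis v vL.
    exact: (liev_sub_subalgebra Asub PA PA) (subvP P2 _ vL).
  apply: (liev_sub_subalgebra Asub PA (IHi (ltnW lis))).
  apply: subvP vL; rewrite /L !glayerE //.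
  exact: (gcomp_sub_liev (i := i.+2) lis pP p0 (subvv _)).
case: (Asub) => A0 Alin _.
have /mem_gsupp[w1 w1'] := subvP (lower_central R k s 1) _ w2.
(* Index 0 is the first layer, where an element of the derived algebra has no component. *)
rewrite (galg_decomp w s0); elim/big_rec: _ => // -[[|i] lis] u _ Au /=.
  suff -> : trunc true (pred1 1%N) w = 0 by rewrite add0r.
  congr pair; first exact: w1.
  apply: eq_coef => j b jb; rewrite linear0 coef_seq_of jb /=.
  by case: eqP => // ->; apply: w1'.
rewrite -[X in X + _]scale1r; apply: Alin => //; apply: (LA i lis).
exact: trunc_glayer i.+1 w.
Qed.
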